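(* Let $G$ be a finite simplicial graph, let $\Gamma=A(G)$ be the associated right-angled Artin group, and let $X$ be the universal covering of the Salvetti complex of $G$. Let $\gamma\in\Gamma\setminus\{1\}$ and let $x$ be a vertex of $X$. Then there exist $l\in\mathbb{N}$, $l\ge1$, and an $\mathcal{H}$-segment $s=(h_1\supset\cdots\supset h_l)$ of length $l$ in $X$ such that $\bar f_{s,x}(\gamma)\geq1$ and such that $\{\lambda(h_1),\lambda(h_l)\}$ is an independent set in $G$ (i.e. $\lambda(h_1)$ and $\lambda(h_l)$ are not joined by an edge of $G$), where $\bar f_{s,x}$ denotes the homogenisation of $f_{s,x}$.
   Context: RAAGs: $A(G)=\langle V(G)\mid vw=wv \text{ for } \{v,w\}\in E(G)\rangle$. The Salvetti complex $S(G)$ is the non-positively curved cube complex obtained from the presentation complex by gluing in a $k$-cube ($k$-torus) for each $k$-clique of $G$. Its universal covering $X$ is a $\mathrm{CAT}(0)$ cube complex: its $1$-skeleton is the Cayley graph of $\Gamma$ with respect to $V(G)$ (edges $\{g,gv\}$), it has one cube spanned by $\{g\prod_{v\in B}v : B\subseteq C\}$ for each $g\in\Gamma$ and each clique $C$, and $\Gamma$ acts freely by left multiplication. The label of the edge $\{g,gv\}$ is $v\in V(G)$. Halfspaces: let $D$ be the combinatorial path metric on the vertex set $V$ in the $1$-skeleton of $X$. For an edge $e$ with endpoints $a,b$, $V$ is the disjoint union of $\{v: D(v,a)<D(v,b)\}$ and $\{v: D(v,b)<D(v,a)\}$; each of these is called a halfspace, dual to $e$. All edges dual to the same halfspace $h$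 have the same label, denoted $\lambda(h)$. For $x,y\in V$, $[x,y]_{\mathcal{H}}$ is the (finite) set of halfspaces containing $y$ but not $x$. Halfspaces $h\supset k$ are tightly nested if they are distinct and there is no halfspace $h'\neq h,k$ with $h\supset h'\supset k$. An $\mathcal{H}$-segment of length $l\geq1$ is a sequence $(h_1\supset\cdots\supset h_l)$ of halfspaces with consecutive ones tightly nested. Elements of $\Gamma s$ are called translates of $s$; a segment is contained in $[x,y]_{\mathcal{H}}$ if all its halfspaces are. Median quasimorphisms: $f_s(x,y)$ is the number of translates of $s$ contained in $[x,y]_{\mathcal{H}}$ minus the number of translates of $s$ contained in $[y,x]_{\mathcal{H}}$, and $f_{s,x}\colon\Gamma\to\mathbb{R}$, $f_{s,x}(\gamma):=f_s(x,\gamma x)$. This is a quasimorphism, i.e. $\sup_{\gamma,\lambda}|f_{s,x}(\gamma)+f_{s,x}(\lambda)-f_{s,x}(\gamma\lambda)|<\infty$. The homogenisation of a quasimorphism $f$ is $\bar f(\gamma):=\lim_{n\to\infty}f(\gamma^n)/n$. *)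

(* Defs.v *)
From HB Require Import structures.
From mathcomp Require Import all_boot all_order all_algebra finmap.
From mathcomp Require Import all_classical all_reals all_analysis.

Set Implicit Arguments.
Unset Strict Implicit.
Unset Printing Implicit Defensive.

Import numFieldNormedType.Exports.

Local Open Scope classical_set_scope.
Local Open Scope quotient_scope.
Local Open Scope group_scope.

(* Words in the generators and their formal inverses: the letter (v, true)
   stands for v and (v, false) for v^-1. *)
Local Notation word V := (seq (V * bool)).

Section RAAG.
Variables (V : finType) (e : rel V).
Implicit Types w : word V.

Inductive raag_rel : word V -> word V -> Prop :=
| raag_refl w : raag_rel w w
| raag_sym w1 w2 : raag_rel w1 w2 -> raag_rel w2 w1
| raag_trans w1 w2 w3 : raag_rel w1 w2 -> raag_rel w2 w3 -> raag_rel w1 w3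
| raag_cat w1 w1' w2 w2' :
    raag_rel w1 w1' -> raag_rel w2 w2' -> raag_rel (w1 ++ w2) (w1' ++ w2')
| raag_cancel v b : raag_rel [:: (v, b); (v, ~~ b)] [::]
| raag_comm u v : e u v ->
    raag_rel [:: (u, true); (v, true)] [:: (v, true); (u, true)].

Definition raag_relb w1 w2 : bool := `[< raag_rel w1 w2 >].

Lemma raag_relb_equiv : equiv_class_of raag_relb.
Proof.
split=> [w|w1 w2|w2 w1 w3].
- by apply/asboolP; exact: raag_refl.
- by apply/asboolP/asboolP; exact: raag_sym.
- by move=> /asboolP h1 /asboolP h2; apply/asboolP; exact: raag_trans h2.
Qed.

Canonical raag_equiv := EquivRelPack raag_relb_equiv.

Definition raag := {eq_quot raag_equiv}.
HB.instance Definition _ := Choice.on raag.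

Definition raag_of_word w : raag := \pi_{eq_quot raag_equiv} w.

Lemma raag_of_wordP w1 w2 :
  raag_of_word w1 = raag_of_word w2 <-> raag_rel w1 w2.
Proof.
split=> [/eqmodP /asboolP //|h]; by apply/eqmodP/asboolP.
Qed.

Lemma raag_reprK (g : raag) : raag_of_word (repr g) = g.
Proof. exact: reprK. Qed.

Definition inv_word w : word V := rev [seq (l.1, ~~ l.2) | l <- w].

Lemma inv_word_cat w1 w2 : inv_word (w1 ++ w2) = inv_word w2 ++ inv_word w1.
Proof. by rewrite /inv_word map_cat rev_cat. Qed.

Lemma inv_wordK : involutive inv_word.
Proof.
move=> w; rewrite /inv_word map_rev revK -map_comp map_id_in //.
by case=> v b _ /=; rewrite negbK.
Qed.

Lemma raag_mulwV w : raag_rel (w ++ inv_word w) [::].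
Proof.
elim: w => [|[v b] w IH]; first exact: raag_refl.
rewrite -cat1s inv_word_cat -catA (catA w).
have /= := raag_cat IH (raag_refl (inv_word [:: (v, b)])).
move/(raag_cat (raag_refl [:: (v, b)])) => h.
exact: raag_trans h (raag_cancel v b).
Qed.

Lemma raag_mulVw w : raag_rel (inv_word w ++ w) [::].
Proof. by have := raag_mulwV (inv_word w); rewrite inv_wordK. Qed.

Lemma raag_inv w1 w2 :
  raag_rel w1 w2 -> raag_rel (inv_word w1) (inv_word w2).
Proof.
move=> h; rewrite -[inv_word w1]cats0.
apply: raag_trans (raag_cat (raag_refl _) (raag_sym (raag_mulwV w2))) _.
rewrite catA -{2}(cat0s (inv_word w2)).
apply: raag_cat (raag_refl _).
apply: raag_trans (raag_cat (raag_refl _) (raag_sym h)) _.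
exact: raag_mulVw.
Qed.

Definition raag_one : raag := raag_of_word [::].
Definition raag_mul (g h : raag) : raag := raag_of_word (repr g ++ repr h).
Definition raag_invg (g : raag) : raag := raag_of_word (inv_word (repr g)).

Lemma raag_of_word_mul w1 w2 :
  raag_mul (raag_of_word w1) (raag_of_word w2) = raag_of_word (w1 ++ w2).
Proof. by apply/raag_of_wordP/raag_cat; apply/raag_of_wordP/raag_reprK. Qed.

Lemma raag_of_word_inv w :
  raag_invg (raag_of_word w) = raag_of_word (inv_word w).
Proof. by apply/raag_of_wordP/raag_inv; apply/raag_of_wordP/raag_reprK. Qed.

Lemma raag_mulA : associative raag_mul.
Proof.
move=> x y z; rewrite -(raag_reprK x) -(raag_reprK y) -(raag_reprK z).
by rewrite !raag_of_word_mul catA.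
Qed.

Lemma raag_mul1 : left_id raag_one raag_mul.
Proof. by move=> x; rewrite -(raag_reprK x) raag_of_word_mul. Qed.

Lemma raag_1mul : right_id raag_one raag_mul.
Proof. by move=> x; rewrite -(raag_reprK x) raag_of_word_mul cats0. Qed.

Lemma raag_mulV : left_inverse raag_one raag_invg raag_mul.
Proof.
move=> x; rewrite -(raag_reprK x) raag_of_word_inv raag_of_word_mul.
exact/raag_of_wordP/raag_mulVw.
Qed.

Lemma raag_Vmul : right_inverse raag_one raag_invg raag_mul.
Proof.
move=> x; rewrite -(raag_reprK x) raag_of_word_inv raag_of_word_mul.
exact/raag_of_wordP/raag_mulwV.
Qed.

HB.instance Definition _ :=
  isGroup.Build raag raag_mulA raag_mul1 raag_1mul raag_mulV raag_Vmul.

Definition raag_gen (v : V) : raag := raag_of_word [:: (v, true)].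

(* Vertices of the universal cover X of the Salvetti complex are the elements
   of the group; halfspaces and segments only depend on the 1-skeleton, which
   is the Cayley graph. *)
Definition cayley_adj : rel raag := fun x y =>
  [exists v, (y == x * raag_gen v) || (x == y * raag_gen v)].

Definition joined_by_path (x y : raag) (n : nat) : bool :=
  `[< exists p, [/\ path cayley_adj x p, last x p = y & size p = n] >].

Lemma cayley_adj_gen x v b : cayley_adj x (x * raag_of_word [:: (v, b)]).
Proof.
apply/existsP; exists v; case: b; first by rewrite eqxx.
apply/orP; right; rewrite -mulgA [X in _ * X](_ : _ = 1) ?mulg1//.
rewrite [LHS]raag_of_word_mul.
exact/raag_of_wordP/(raag_cancel v false).
Qed.

Lemma raag_connected x y : exists n, joined_by_path x y n.
Proof.
suff H w z : exists n, joined_by_path z (z * raag_of_word w) n.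
  by have := H (repr (x^-1 * y)) x; rewrite raag_reprK mulVKg.
elim: w z => [|[v b] w IH] z.
  exists 0; apply/asboolP; exists [::]; split => //=.
  by rewrite [X in _ * X](_ : _ = 1) // mulg1.
have [n /asboolP[p [hp lp sp]]] := IH (z * raag_of_word [:: (v, b)]).
exists n.+1; apply/asboolP; exists (z * raag_of_word [:: (v, b)] :: p).
split=> //=; [by rewrite cayley_adj_gen| |by rewrite sp].
by rewrite lp -mulgA [X in _ * X]raag_of_word_mul.
Qed.

Definition dist (x y : raag) : nat := ex_minn (raag_connected x y).

Definition closer (a b : raag) : set raag := [set z | (dist z a < dist z b)%N].

Definition dual (h : set raag) (a b : raag) : Prop :=
  cayley_adj a b /\ (h = closer a b \/ h = closer b a).

Definition halfspaces : set (set raag) := [set h | exists a b, dual h a b].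

Definition halfspace : choiceType := set_type halfspaces.

Lemma halfspace_label_ex (h : halfspace) :
  exists v, exists g, dual (val h) g (g * raag_gen v).
Proof.
have /set_mem[a [b [ab hab]]] := valP h.
have /existsP[v /orP[/eqP E|/eqP E]] := ab; exists v.
- by exists a; rewrite -E.
- exists b; rewrite -E; split; last by case: hab; [right|left].
  by apply/existsP; exists v; rewrite E eqxx.
Qed.

(* The label of some edge dual to h; it does not depend on the edge. *)
Definition label (h : halfspace) : V := projT1 (cid (halfspace_label_ex h)).

Lemma cayley_adjM g x y : cayley_adj (g * x) (g * y) = cayley_adj x y.
Proof.
by apply: eq_existsb => v; rewrite -!mulgA !(inj_eq (mulgI g)).
Qed.

Lemma distM g x y : dist (g * x) (g * y) = dist x y.
Proof.
have H k x' y' n :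
    joined_by_path x' y' n -> joined_by_path (k * x') (k * y') n.
  move=> /asboolP[p [hp lp sp]]; apply/asboolP.
  exists [seq k * z | z <- p]; split; last by rewrite size_map.
  - by rewrite path_map; under eq_path do rewrite /= cayley_adjM.
  - by rewrite last_map lp.
apply: eq_ex_minn => n; apply/idP/idP; last exact: H.
by move/(H g^-1); rewrite !mulKg.
Qed.

Lemma translate_halfspace_subproof (g : raag) (h : halfspace) :
  [set g * z | z in val h] \in halfspaces.
Proof.
have E a b : [set g * z | z in closer a b] = closer (g * a) (g * b).
  apply/seteqP; split=> [_ [z hz <-]|z hz]; first by rewrite /closer /= !distM.
  exists (g^-1 * z); last by rewrite mulVKg.
  by move: hz; rewrite /closer /= -{1 2}(mulVKg g z) !distM.
have /set_mem[a [b [ab hab]]] := valP h; apply/mem_set.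
exists (g * a), (g * b); split; first by rewrite cayley_adjM.
by case: hab => ->; rewrite E; [left|right].
Qed.

Definition translate_halfspace (g : raag) (h : halfspace) : halfspace :=
  SigSub (translate_halfspace_subproof g h).

Definition tightly_nested (h k : halfspace) : Prop :=
  [/\ val k `<=` val h, h <> k
    & ~ exists h' : halfspace,
        [/\ h' <> h, h' <> k, val h' `<=` val h & val k `<=` val h']].

Definition segment (s : seq halfspace) : bool :=
  (0 < size s)%N && sorted (fun h k => `[< tightly_nested h k >]) s.

Definition separating (x y : raag) : set halfspace :=
  [set h | val h y /\ ~ val h x].

Definition translates_in (s : seq halfspace) (x y : raag) :
    set (seq halfspace) :=
  [set t | (exists g, t = map (translate_halfspace g) s)
           /\ (forall h, h \in t -> separating x y h)].

(* fset_set is the finite set underlying a finite classical set; translates_in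
   is finite for nonempty s because separating x y is. *)
Definition num_translates_in (s : seq halfspace) (x y : raag) : nat :=
  #|` fset_set (translates_in s x y)|.

Definition independent (A : {set V}) : Prop :=
  {in A &, forall u v, ~~ e u v}.

End RAAG.

Section Quasimorphism.
Variable R : realType.
Local Open Scope ring_scope.

Definition median_f (V : finType) (e : rel V) (s : seq (halfspace e))
    (x y : raag e) : R :=
  (num_translates_in s x y)%:R - (num_translates_in s y x)%:R.

Definition median_qm (V : finType) (e : rel V) (s : seq (halfspace e))
    (x : raag e) : raag e -> R :=
  fun g => median_f s x (g * x)%g.

(* limn returns 0 on a divergent sequence, so a positive lower bound on the
   homogenisation also asserts that the limit exists. *)
Definition homogenisation (G : groupType) (f : G -> R) (g : G) : R :=
  limn (fun n : nat => f (g ^+ n)%g / n%:R).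

End Quasimorphism.

(* Main.v *)
(* Take [y] of minimal displacement under [gamma], [h] the halfspace entered by the
   first edge of a geodesic from [y] to [gamma y], and [s] a chain of tightly
   nested halfspaces from [h] down to [gamma h], whose ends have the same label.
   Walls with equal or non-commuting labels never cross, because the edges of a
   wall labelled v form a coset of the group generated by the link of v. Hence
   a segment inside [x, z]_H is determined by its labels and one of its ends, so
   that the counting functions are Lipschitz in their endpoints and x may be
   moved to [y]. There the number of new translates of [s] in
   [y, gamma^(n+1) y]_H is positive, nondecreasing and bounded, hence
   eventually constant. No translate of [s] occurs backwards: it would provide a
   group element reversing the chain of halfspaces with the label of [h] along
   the axis, hence exchanging two consecutive ones, and among the halfspaces
   strictly between these there would again be two exchanged ones, and so on
   forever inside a finite interval. *)
Require Import Defs.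
From mathcomp Require Import all_boot all_order all_algebra finmap.
From mathcomp Require Import all_classical all_reals all_analysis.
From mathcomp Require Import lra.

Set Implicit Arguments.
Unset Strict Implicit.
Unset Printing Implicit Defensive.

Import numFieldNormedType.Exports.
Import Order.TTheory GRing.Theory Num.Theory.

Local Open Scope ring_scope.
Local Open Scope classical_set_scope.

(** * Limits of almost linear sequences and bounded monotone sequences *)

Lemma limn_div (R : realType) (f : nat -> R) (c B : R) (N : nat) :
    (forall n, (N <= n)%N -> `|f n - n%:R * c| <= B) ->
  limn (fun n => f n / n%:R) = c.
Proof.
move=> fB; apply/cvg_lim => //; apply/cvgrPdist_le => eps eps0.
near=> n.
have n0 : 0 < n%:R :> R by rewrite ltr0n; near: n; exact: nbhs_infty_gt.
have -> : c - f n / n%:R = - (f n - n%:R * c) / n%:R.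
  by rewrite mulNr mulrBl mulrAC divff ?lt0r_neq0// mul1r opprB.
rewrite normrM normrN normfV (gtr0_norm n0) ler_pdivrMr//.
apply: (le_trans (fB n _)); first by near: n; exact: nbhs_infty_ge.
rewrite mulrC -ler_pdivrMr//; near: n; exact: nbhs_infty_ger.
Unshelve. all: by end_near.
Qed.

(** [N] is an index at which the largest value is attained. *)
Lemma nondecreasing_bounded_const (d : nat -> nat) (B : nat) :
    (forall n, (d n <= d n.+1)%N) -> (forall n, (d n <= B)%N) ->
  exists N, forall n, (N <= n)%N -> d n = d N.
Proof.
move=> dS dB.
have ex : exists v, `[< exists n, d n = v >].
  by exists (d 0); apply/asboolP; exists 0%N.
have ub v : `[< exists n, d n = v >] -> (v <= B)%N by move=> /asboolP[n <-].
have [_ /asboolP[N <-] dmax] := ex_maxnP ex ub.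
exists N => n Nn; apply/eqP; rewrite eqn_leq dmax; last by apply/asboolP; exists n.
exact: (homo_leq (@leqnn) (@leq_trans) dS).
Qed.

Local Open Scope group_scope.

(** * Cardinalities of finite sets *)

Section FiniteSets.
Variables T U : choiceType.
Implicit Types A B : set T.

Lemma card_fset_set_le A B : finite_set B -> A `<=` B ->
  (#|` fset_set A| <= #|` fset_set B|)%N.
Proof.
move=> fB AB; have fA := sub_finite_set AB fB.
by apply: fsubset_leq_card; move: AB; rewrite fset_set_sub.
Qed.

Lemma card_fset_set_lt A B x : finite_set B -> A `<=` B -> B x -> ~ A x ->
  (#|` fset_set A| < #|` fset_set B|)%N.
Proof.
move=> fB AB Bx nAx; have fA := sub_finite_set AB fB.
apply: fproper_ltn_card; rewrite fproperE; apply/andP; split.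
  by move: AB; rewrite fset_set_sub.
by apply/negP; rewrite -fset_set_sub// => /(_ _ Bx).
Qed.

Lemma card_fset_set_inj A (B : set U) (f : T -> U) :
    finite_set A -> finite_set B -> (forall x, A x -> B (f x)) ->
    (forall x y, A x -> A y -> f x = f y -> x = y) ->
  (#|` fset_set A| <= #|` fset_set B|)%N.
Proof.
move=> fA fB fAB finj.
have <- : #|` [fset f x | x in fset_set A]%fset| = #|` fset_set A|.
  by apply: card_in_imfset => x y; rewrite !in_fset_set ?inE//; exact: finj.
apply: fsubset_leq_card; apply/fsubsetP => y /imfsetP[x /=].
by rewrite !in_fset_set ?inE// => /fAB ? ->.
Qed.

Lemma card_fset_setU A B : finite_set A -> finite_set B ->
    (forall x, A x -> ~ B x) ->
  #|` fset_set (A `|` B)| = (#|` fset_set A| + #|` fset_set B|)%N.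
Proof.
move=> fA fB AB; rewrite fset_setU// cardfsU.
suff -> : (fset_set A `&` fset_set B)%fset = fset0 by rewrite cardfs0 subn0.
apply/fsetP => x; rewrite inE !in_fset_set// inE; apply/negbTE/negP => /andP[].
by rewrite !inE => /AB.
Qed.

Lemma card_fset_setU_le A B : finite_set A -> finite_set B ->
  (#|` fset_set (A `|` B)| <= #|` fset_set A| + #|` fset_set B|)%N.
Proof. by move=> fA fB; rewrite fset_setU// leq_card_fsetU. Qed.

Lemma card_fset_set_gt0 A x : finite_set A -> A x -> (0 < #|` fset_set A|)%N.
Proof.
move=> fA Ax; rewrite cardfs_gt0; apply/fset0Pn; exists x.
by rewrite in_fset_set ?inE.
Qed.

End FiniteSets.

(** Inside [D] an element and the [f]-value of its successor determine that successor, so the chain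
    is rebuilt step by step from its head. It is applied to segments read in either direction, with
    [f] the label and [D] a separating set. *)
Lemma sorted_map_inj (T T' : eqType) (D : set T) (r : rel T) (f : T -> T') s t :
    (forall a b c, D b -> D c -> r a b -> r a c -> f b = f c -> b = c) ->
    sorted r s -> sorted r t -> ohead s = ohead t -> map f s = map f t ->
    (forall a, a \in s -> D a) -> (forall a, a \in t -> D a) -> s = t.
Proof.
move=> det; case: s t => [|a s] [|a' t] //= rs rt [Ea] [_]; subst a'.
elim: s t a rs rt => [|b s IH] [|c t] a //= /andP[ab bs] /andP[ac ct] [fbc fst] Ds Dt.
have bD : D b by apply: Ds; rewrite !inE eqxx orbT.
have cD : D c by apply: Dt; rewrite !inE eqxx orbT.
have Ebc := det a b c bD cD ab ac fbc; rewrite -Ebc in ct Dt *.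
congr (_ :: _); apply: IH => // i hi; first by apply: Ds; rewrite inE hi orbT.
by apply: Dt; rewrite inE hi orbT.
Qed.

(** * Walls and halfspaces *)

Section Walls.
Variables (V : finType) (e : rel V).
Hypotheses (e_sym : symmetric e) (e_irr : irreflexive e).
Implicit Types (a g x y z : raag e) (u v : V) (l : V * bool).

(** * Letters, links and walls *)

Definition letter l : raag e := raag_of_word e [:: l].
Definition opp_letter l : V * bool := (l.1, ~~ l.2).

Lemma opp_letterK : involutive opp_letter.
Proof. by case=> v b; rewrite /opp_letter /= negbK. Qed.

Lemma raag_of_word_cat w1 w2 :
  raag_of_word e (w1 ++ w2) = raag_of_word e w1 * raag_of_word e w2.
Proof. by rewrite -raag_of_word_mul. Qed.

Lemma raag_of_word_cons l w :
  raag_of_word e (l :: w) = letter l * raag_of_word e w.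
Proof. exact: (raag_of_word_cat [:: l]). Qed.

Lemma raag_of_word0 : raag_of_word e [::] = 1.
Proof. by []. Qed.

Lemma letterV l : letter (opp_letter l) = (letter l)^-1.
Proof.
apply/(mulgI (letter l)); rewrite mulgV -raag_of_word_cat.
by apply/raag_of_wordP; case: l => v b; exact: raag_cancel.
Qed.

Lemma letterC_pos u v : e u v ->
  commute (letter (u, true)) (letter (v, true)).
Proof.
move=> uv; rewrite /commute -!raag_of_word_cat.
exact/raag_of_wordP/raag_comm.
Qed.

Lemma commuteVl x y : commute x y -> commute x^-1 y.
Proof.
by move=> xy; apply: (mulgI x); rewrite /commute mulVKg mulgA xy mulgK.
Qed.

Lemma letterC l l' : e l.1 l'.1 -> commute (letter l) (letter l').
Proof.
case: l l' => u b [v c] /= uv.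
have C := letterC_pos uv.
have H b' : commute (letter (u, b')) (letter (v, true)).
  by case: b' => //; rewrite (letterV (u, true)); apply: commuteVl.
case: c => //; rewrite (letterV (v, true)); apply/esym/commuteVl/esym/H.
Qed.

(** The subgroup generated by the neighbours of [v] in the graph. *)
Inductive link_group v : raag e -> Prop :=
| link_group1 : link_group v 1
| link_groupMl g l : e v l.1 -> link_group v g -> link_group v (g * letter l).

Lemma link_groupM v x y :
  link_group v x -> link_group v y -> link_group v (x * y).
Proof.
move=> hx; elim=> [|g l vl _ IH]; first by rewrite mulg1.
by rewrite mulgA; exact: link_groupMl.
Qed.

Lemma link_group_letter v l : e v l.1 -> link_group v (letter l).
Proof. by rewrite -(mul1g (letter l)) => vl; apply/link_groupMl/link_group1. Qed.

Lemma link_groupV v x : link_group v x -> link_group v x^-1.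
Proof.
elim=> [|g l vl _ IH]; first by rewrite invg1; exact: link_group1.
rewrite invgM -letterV; apply: link_groupM IH.
exact: link_group_letter.
Qed.

Lemma link_groupC v x b : link_group v x -> commute x (letter (v, b)).
Proof.
elim=> [|g l vl _ IH]; first by rewrite /commute mul1g mulg1.
rewrite /commute -mulgA (letterC (l' := (v, b))) ?(e_sym l.1)//.
by rewrite !mulgA IH.
Qed.

Lemma link_group_sym v a (b : raag e) :
  link_group v (a^-1 * b) -> link_group v (b^-1 * a).
Proof. by move/link_groupV; rewrite invgM invgK. Qed.

Lemma link_group_trans v a (b c : raag e) : link_group v (a^-1 * b) ->
  link_group v (b^-1 * c) -> link_group v (a^-1 * c).
Proof. by move=> h /(link_groupM h); rewrite -mulgA mulVKg. Qed.

(* The wall [(k, v)] consists of the edges [{g, gv}] with [g] in the coset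
   [k <link v>]; [cross k v a l] says that [{a, a l}] is such an edge. *)
Definition cross k v a l : bool :=
  (l.1 == v) && `[< link_group v (k^-1 * (if l.2 then a else a * letter l)) >].

(** The parity of the number of times that the path from [a] spelling [w] crosses the wall. *)
Fixpoint crossings k v a (w : seq (V * bool)) : bool :=
  if w is l :: w' then cross k v a l (+) crossings k v (a * letter l) w'
  else false.

Lemma crossings_cat k v a w1 w2 :
  crossings k v a (w1 ++ w2) =
  crossings k v a w1 (+) crossings k v (a * raag_of_word e w1) w2.
Proof.
elim: w1 a => [|l w1 IH] a /=; first by rewrite raag_of_word0 mulg1.
by rewrite IH raag_of_word_cons mulgA addbA.
Qed.

(** The two edges are opposite sides of a square, hence belong to the same wall. *)
Lemma crossM k v a l l' : e l.1 l'.1 ->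
  cross k v (a * letter l) l' = cross k v a l'.
Proof.
move=> ll'; rewrite /cross; case: eqVneq => //= l'v.
apply: asbool_equiv_eq.
have -> : (if l'.2 then a * letter l else a * letter l * letter l') =
          (if l'.2 then a else a * letter l') * letter l.
  by case: l'.2 => //; rewrite -!mulgA (letterC ll').
have vl : e v l.1 by rewrite -l'v e_sym.
rewrite mulgA; split=> [/link_groupM H|H]; last exact: link_groupMl.
have := H _ (link_groupV (link_group_letter vl)).
by rewrite mulgK.
Qed.

(** A cancelling pair runs through one edge twice, and a commuting square has its opposite edges in
    the same wall. So the parity depends only on the two ends of the path. *)
Lemma crossings_rel k v w1 w2 : raag_rel e w1 w2 ->
  forall a, crossings k v a w1 = crossings k v a w2.
Proof.
elim=> {w1 w2} [//|w1 w2 _ IH a|w1 w2 w3 _ IH1 _ IH2 a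
    |w1 w1' w2 w2' /raag_of_wordP E IH1 _ IH2 a|u b a|u u' uu' a].
- by rewrite IH.
- by rewrite IH1.
- by rewrite !crossings_cat IH1 IH2 E.
- rewrite /= /cross /= addbF -mulgA.
  have -> : letter (u, b) * letter (u, ~~ b) = 1.
    by rewrite -[(u, ~~ b)]/(opp_letter (u, b)) letterV mulgV.
  by rewrite mulg1; case: b => /=; rewrite addbb.
- by rewrite /= !addbF !crossM// 1?e_sym// addbC.
Qed.

(** By [crossings_rel] the word chosen by [repr] is immaterial; the side of [k] itself is
    [false]. *)
Definition side k v z : bool := crossings k v k (repr (k^-1 * z)).

Lemma side_step k v z w :
  side k v (z * raag_of_word e w) = side k v z (+) crossings k v z w.
Proof.
rewrite /side -[X in _ = _ (+) crossings _ _ X _](mulVKg k).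
rewrite -[X in crossings k v (k * X)]raag_reprK -crossings_cat.
apply: crossings_rel; apply/raag_of_wordP.
by rewrite raag_of_word_cat !raag_reprK mulgA.
Qed.

Lemma side_letter k v z l : side k v (z * letter l) = side k v z (+) cross k v z l.
Proof. by rewrite side_step /= addbF. Qed.

Lemma crossings_refl k v : side k v k = false.
Proof.
have /(crossings_rel k v) H : raag_rel e (repr (k^-1 * k)) [::].
  by apply/raag_of_wordP; rewrite raag_reprK mulVg.
by rewrite /side H.
Qed.

Lemma side_coset k v p : link_group v p -> side k v (k * p) = false.
Proof.
elim=> [|g l vl _ IH]; first by rewrite mulg1 crossings_refl.
rewrite mulgA side_letter IH /cross; case: eqVneq => //= E.
by move: vl; rewrite E e_irr.
Qed.

Lemma side_cosetM k v p : link_group v p ->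
  side k v (k * p * letter (v, true)) = true.
Proof.
move=> vp; rewrite side_letter side_coset//= /cross eqxx /=.
by apply/asboolP; rewrite mulKg.
Qed.

(** * Geodesics, and halfspaces as sides of walls *)

Lemma dist_word z w : (dist z (z * raag_of_word e w)%g <= size w)%N.
Proof.
rewrite /dist; case: ex_minnP => m _; apply; apply/asboolP.
elim: w z => [|l w IH] z; first by exists [::]; rewrite raag_of_word0 mulg1.
have [p [hp lp sp]] := IH (z * letter l).
exists (z * letter l :: p); split=> /=; rewrite ?sp//.
  by rewrite hp andbT; case: l {IH lp hp} => v b; exact: cayley_adj_gen.
by rewrite lp raag_of_word_cons mulgA.
Qed.

Lemma cayley_adj_letter x y : cayley_adj x y -> exists l, y = x * letter l.
Proof.
move=> /existsP[v /orP[/eqP->|/eqP->]]; first by exists (v, true).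
by exists (v, false); rewrite (letterV (v, true)) mulgK.
Qed.

Lemma geodesic_word x y :
  exists2 w, y = x * raag_of_word e w & size w = dist x y.
Proof.
rewrite /dist; case: ex_minnP => _ /asboolP[p [hp <- <-]] _.
elim: p x hp => [|z p IH] x /=; first by exists [::]; rewrite ?raag_of_word0 ?mulg1.
move=> /andP[/cayley_adj_letter[l ->]] /IH[w -> <-].
by exists (l :: w); rewrite // raag_of_word_cons mulgA.
Qed.

Lemma dist0 x y : dist x y = 0%N -> x = y.
Proof.
by have [w -> <-] := geodesic_word x y; case: w => //; rewrite raag_of_word0 mulg1.
Qed.

Lemma dist_sym x y : dist x y = dist y x.
Proof.
suff H a (b : raag e) : (dist a b <= dist b a)%N by apply/eqP; rewrite eqn_leq !H.
have [w -> <-] := geodesic_word b a.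
have -> : size w = size (inv_word w) by rewrite size_rev size_map.
rewrite -{2}(mulgK (raag_of_word e w) b).
suff -> : (raag_of_word e w)^-1 = raag_of_word e (inv_word w) by exact: dist_word.
exact: raag_of_word_inv.
Qed.

Lemma crossing_split k v a w : crossings k v a w ->
  exists w1 l w2, [/\ w = w1 ++ l :: w2, crossings k v a w1 = false
    & cross k v (a * raag_of_word e w1) l].
Proof.
elim: w a => [//|l w IH] a /=; case E: (cross k v a l) => /=.
  by exists [::], l, w; split => //; rewrite raag_of_word0 mulg1.
move=> /IH[w1 [l' [w2 [-> h1 h2]]]].
exists (l :: w1), l', w2; split => //=; first by rewrite E h1.
by rewrite raag_of_word_cons mulgA.
Qed.

(** A geodesic from [z] to [k] must cross the wall. Deleting the letter of its first crossing keeps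
    the rest of the path on the other side of the wall, where it ends at the other end of the edge,
    one letter earlier. *)
Lemma side_true_dist k v z :
  side k v z = true -> (dist z (k * letter (v, true))%g < dist z k)%N.
Proof.
move=> sz; have [w Ew <-] := geodesic_word z k.
have : crossings k v z w.
  by have := side_step k v z w; rewrite -Ew crossings_refl sz; case: crossings.
move=> /crossing_split[w1 [l [w2 [Ew12 h1 h2]]]].
set c := z * raag_of_word e w1 in h2.
have sc : side k v c = true by rewrite side_step sz h1.
case: l h2 Ew12 => v' [] /andP[/= /eqP-> /asboolP].
  by move=> /(side_coset k); rewrite mulVKg sc.
set c' := c * letter (v, false) => vc Ew12.
(* [w2] spells an element of the link subgroup of [v], so the deleted letter can be moved past
   it. *)
have -> : k * letter (v, true) = z * raag_of_word e (w1 ++ w2).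
  rewrite raag_of_word_cat mulgA -/c.
  have E : k = c' * raag_of_word e w2.
    by rewrite Ew Ew12 raag_of_word_cat raag_of_word_cons !mulgA.
  have Ew2 : raag_of_word e w2 = c'^-1 * k by rewrite E mulKg.
  rewrite {1}E -mulgA link_groupC; last by rewrite Ew2; exact: link_group_sym.
  by rewrite mulgA /c' (letterV (v, true)) mulgVK.
by apply: leq_ltn_trans (dist_word _ _) _; rewrite Ew12 !size_cat /= addnS.
Qed.

(** The same deletion, applied to a geodesic towards the far end of the edge. *)
Lemma side_false_dist k v z :
  side k v z = false -> (dist z k < dist z (k * letter (v, true))%g)%N.
Proof.
move=> sz; have [w Ew <-] := geodesic_word z (k * letter (v, true)).
have sk : side k v (k * letter (v, true)) = true.
  by have := side_cosetM k (link_group1 v); rewrite mulg1.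
have : crossings k v z w.
  by have := side_step k v z w; rewrite -Ew sk sz; case: crossings.
move=> /crossing_split[w1 [l [w2 [Ew12 h1 h2]]]].
set c := z * raag_of_word e w1 in h2.
have sc : side k v c = false by rewrite side_step sz h1.
case: l h2 Ew12 => v' [] /andP[/= /eqP-> /asboolP]; last first.
  move=> /(side_cosetM k); rewrite mulVKg (letterV (v, true)) mulgVK.
  by rewrite sc.
move=> vc Ew12.
have -> : k = z * raag_of_word e (w1 ++ w2).
  rewrite raag_of_word_cat mulgA -/c.
  have E : k * letter (v, true) = c * letter (v, true) * raag_of_word e w2.
    by rewrite Ew Ew12 raag_of_word_cat raag_of_word_cons !mulgA.
  have : c^-1 * k * letter (v, true) = letter (v, true) * raag_of_word e w2.
    by rewrite -(mulgA c^-1) E -(mulgA c) mulKg.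
  rewrite link_groupC; last exact: link_group_sym.
  by move/mulgI => <-; rewrite mulVKg.
by apply: leq_ltn_trans (dist_word _ _) _; rewrite Ew12 !size_cat /= addnS.
Qed.

(* The side of [a l] of the wall crossed by the edge [{a, a l}]; every halfspace
   is of this form, with [l] unique. *)
Definition hs a l : set (raag e) := closer (a * letter l) a.

(** The two distance lemmas turn the metric definition into a parity. For a negative letter the wall
    is based at the far end of the edge, hence the conditional. *)
Lemma hs_side a l z :
  hs a l z <-> side (if l.2 then a else a * letter l) l.1 z = l.2.
Proof.
have H k v : (dist z (k * letter (v, true))%g < dist z k)%N = side k v z.
  case E: side; first by rewrite side_true_dist.
  by apply/negbTE; rewrite -leqNgt ltnW// side_false_dist.
rewrite /hs /closer /=; case: l => v [] /=; first by rewrite H.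
set k := a * letter (v, false).
have -> : a = k * letter (v, true) by rewrite /k (letterV (v, true)) mulgVK.
split; last by move/side_false_dist.
by move=> h; apply/negbTE; rewrite -H -leqNgt ltnW.
Qed.

Lemma letterVK a l : a * letter l * letter (opp_letter l) = a.
Proof. by rewrite letterV mulgK. Qed.

Lemma letterKV a l : a * letter (opp_letter l) * letter l = a.
Proof. by rewrite letterV mulgVK. Qed.

Lemma hsC a l : ~` hs a l = hs (a * letter l) (opp_letter l).
Proof.
apply/seteqP; split=> z; rewrite /setC /= !hs_side /= letterVK;
  by case: l.2; case: side => //= h; exfalso; apply: h.
Qed.

Lemma hsN a l z : ~ hs a l z <-> hs (a * letter l) (opp_letter l) z.
Proof. by rewrite -hsC. Qed.

Lemma hs_start a l : ~ hs a l a.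
Proof.
suff : dist a a = 0%N by rewrite /hs /closer /= => ->.
by apply/eqP; rewrite -leqn0 -{2}(mulg1 a); exact: (dist_word a [::]).
Qed.

Lemma hs_end a l : hs a l (a * letter l).
Proof.
have := @hs_start (a * letter l) (opp_letter l).
by rewrite -hsN => h; apply: contrapT.
Qed.

(** Only an edge of the wall changes the side, and the side being entered forces its sign. *)
Lemma hs_enter a l b l' : ~ hs a l b -> hs a l (b * letter l') ->
  l' = l /\ link_group l.1 (a^-1 * b).
Proof.
rewrite !hs_side side_letter => h1 h2.
case C: (cross _ _ b l') h2; last by rewrite addbF => /h1.
move: C h1 => /andP[/eqP E1 /asboolP vl] _ h2.
move: vl h2; case: l E1 => v c; case: l' => v' c' /= ->.
set k := (if c then a else _) => vl.
case: c' vl => vl; rewrite addbT.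
- have -> : side k v b = false by rewrite -(mulVKg k b) side_coset.
  by move=> hc; move: hc vl; rewrite /k; case: c {k}.
- have -> : side k v b = true.
    rewrite -[b](mulgVK (letter (v, true))) -(mulVKg k (b * _)) side_cosetM//.
    by rewrite -letterV.
  move=> hc; split; first by rewrite -hc.
  move: vl; rewrite /k -hc /= => vl.
  have {1}-> : a^-1 * b = letter (v, false) *
      ((a * letter (v, false))^-1 * (b * letter (v, false))) * letter (v, true).
    by rewrite invgM !(letterV (v, true)) invgK !mulgA mulVg mul1g mulgVK.
  rewrite -mulgA (link_groupC _ vl) mulgA (letterV (v, true)) mulVg mul1g.
  by rewrite -(letterV (v, true)).
Qed.

Lemma cross_coset k k' v a l :
  link_group v (k^-1 * k') -> cross k v a l = cross k' v a l.
Proof.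
move=> kk'; rewrite /cross; congr (_ && _); apply: asbool_equiv_eq.
by split; apply: link_group_trans => //; exact: link_group_sym.
Qed.

Lemma crossings_coset k k' v a w :
  link_group v (k^-1 * k') -> crossings k v a w = crossings k' v a w.
Proof.
by move=> kk'; elim: w a => //= l w IH a; rewrite IH (cross_coset _ _ kk').
Qed.

Lemma side_coset_eq k k' v z :
  link_group v (k^-1 * k') -> side k v z = side k' v z.
Proof.
move=> kk'; rewrite -(mulVKg k' z) -(raag_reprK (k'^-1 * z)) !side_step.
rewrite (crossings_coset _ _ kk') crossings_refl.
by rewrite -(mulVKg k k') side_coset.
Qed.

Lemma hs_coset a (b : raag e) l : link_group l.1 (a^-1 * b) -> hs a l = hs b l.
Proof.
move=> vab.
have S z : side (if l.2 then a else a * letter l) l.1 z =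
           side (if l.2 then b else b * letter l) l.1 z.
  apply: side_coset_eq; case: l vab => v [] //= vab.
  by rewrite invgM -mulgA (mulgA a^-1) (link_groupC _ vab) mulKg.
by apply/seteqP; split=> z; rewrite !hs_side S.
Qed.

Lemma hs_exit a l (b : raag e) l' : hs a l b -> ~ hs a l (b * letter l') ->
  l' = opp_letter l /\ link_group l.1 (a^-1 * (b * letter l')).
Proof.
move=> h1 h2; have := @hs_enter a l (b * letter l') (opp_letter l') h2.
by rewrite letterVK => /(_ h1)[<- ?]; rewrite opp_letterK.
Qed.

Lemma hs_change a l z l' : ~ (hs a l z <-> hs a l (z * letter l')) ->
  exists2 c, link_group l.1 (a^-1 * c) & z = c \/ z = c * letter l.
Proof.
move=> h; have [hz|hz] := pselect (hs a l z).
  have [|E vc] := @hs_exit _ _ _ l' hz; first by move=> ?; apply: h.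
  exists (z * letter l') => //; right.
  by rewrite E letterKV.
have [|E vc] := @hs_enter _ _ _ l' hz; first by apply: contrapT => ?; apply: h.
by exists z => //; left.
Qed.

(** The coset of [a] is traversed by letters linked to [l], none of which has the label of [l'], so
    none crosses the second wall. An edge of the first wall that crossed the second would identify
    the halfspaces up to complement. *)
Lemma hs_wall_side a l (b : raag e) l' c : ~~ e l.1 l'.1 ->
    hs a l <> hs b l' -> hs a l <> ~` hs b l' -> link_group l.1 (a^-1 * c) ->
  (hs b l' c <-> hs b l' a) /\ (hs b l' (c * letter l) <-> hs b l' a).
Proof.
move=> ll' AB AnB vc.
have H p : link_group l.1 p -> (hs b l' (a * p) <-> hs b l' a).
  elim=> [|g l0 ll0 _ IH]; first by rewrite mulg1.
  rewrite -IH mulgA; apply: iff_sym; apply: contrapT => h.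
  suff E : l0.1 = l'.1 by move: ll'; rewrite -E ll0.
  have [hz|hz] := pselect (hs b l' (a * g)).
    have [|-> //] := @hs_exit _ _ _ l0 hz; by move=> ?; apply: h.
  by have [|-> //] := @hs_enter _ _ _ l0 hz; apply: contrapT => ?; apply: h.
have Hc := H _ vc; rewrite mulVKg in Hc; split=> //; rewrite -Hc.
apply: iff_sym; apply: contrapT => h.
have [hz|hz] := pselect (hs b l' c).
  have [|E vc'] := @hs_exit _ _ _ l hz; first by move=> ?; apply: h.
  apply: AnB; rewrite (hs_coset vc) (hs_coset vc') hsC.
  by rewrite E letterKV.
have [|E vc'] := @hs_enter _ _ _ l hz; first by apply: contrapT => ?; apply: h.
by apply: AB; rewrite (hs_coset vc) E; apply/esym/hs_coset.
Qed.

(* Walking from [z] towards [a], one cannot leave the quadrant of [z]: each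
   wall is only met on one side of the other. *)
Lemma hs_quadrant a l (b : raag e) l' z : ~~ e l.1 l'.1 ->
    hs a l <> hs b l' -> hs a l <> ~` hs b l' ->
  (hs a l z <-> hs a l b) \/ (hs b l' z <-> hs b l' a).
Proof.
move=> ll' AB AnB.
have l'l : ~~ e l'.1 l.1 by rewrite e_sym.
have BA : hs b l' <> hs a l by move=> E; apply: AB.
have BnA : hs b l' <> ~` hs a l by move=> E; apply: AnB; rewrite E setCK.
apply: contrapT => /not_orP[nA nB].
have H w : ~ (hs a l (z * raag_of_word e w) <-> hs a l b) /\
           ~ (hs b l' (z * raag_of_word e w) <-> hs b l' a).
  elim: w z nA nB => [|l0 w IH] x nA nB; first by rewrite raag_of_word0 mulg1.
  rewrite raag_of_word_cons mulgA; apply: IH.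
  - suff -> : hs a l (x * letter l0) <-> hs a l x by [].
    apply: iff_sym; apply: contrapT => /hs_change[c vc Ex]; apply: nB.
    by have [h1 h2] := hs_wall_side ll' AB AnB vc; case: Ex => ->.
  - suff -> : hs b l' (x * letter l0) <-> hs b l' x by [].
    apply: iff_sym; apply: contrapT => /hs_change[c vc Ex]; apply: nA.
    by have [h1 h2] := hs_wall_side l'l BA BnA vc; case: Ex => ->.
have := H (repr (z^-1 * a)); rewrite raag_reprK mulVKg; tauto.
Qed.

(** [hs_quadrant] empties one of the four quadrants. Since [x] lies outside both halfspaces and [z]
    inside both, the empty quadrant is one of the two set differences. *)
Lemma hs_comparable a l (b : raag e) l' x z : ~~ e l.1 l'.1 ->
    ~ hs a l x -> ~ hs b l' x -> hs a l z -> hs b l' z ->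
  hs a l `<=` hs b l' \/ hs b l' `<=` hs a l.
Proof.
move=> ll' Ax Bx Az Bz.
have [->|/eqP AB] := eqVneq (hs a l) (hs b l'); first by left.
have AnB : hs a l <> ~` hs b l' by move=> E; move: Ax; rewrite E; tauto.
have Q y := hs_quadrant y ll' AB AnB.
have [hA|hA] := pselect (hs a l b); have [hB|hB] := pselect (hs b l' a).
- by have := Q x; tauto.
- by right=> y By; have := Q y; tauto.
- by left=> y Ay; have := Q y; tauto.
- by have := Q z; tauto.
Qed.

(** * Labels, translates and complements of halfspaces *)

Implicit Types h k : halfspace e.

Lemma hs_halfspace a l : hs a l \in @halfspaces V e.
Proof.
apply/mem_set; exists a, (a * letter l); split; last by right.
by case: l => v b; exact: cayley_adj_gen.
Qed.

Definition mkhs a l : halfspace e := SigSub (hs_halfspace a l).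

Lemma halfspaceP h : exists a l, val h = hs a l.
Proof.
have /set_mem[a [b [ab hab]]] := valP h.
have [l E] := cayley_adj_letter ab; case: hab => ->.
  by exists b, (opp_letter l); rewrite /hs E letterVK.
by exists a, l; rewrite /hs E.
Qed.

Lemma halfspace_neq0 h : exists z, val h z.
Proof. by have [a [l ->]] := halfspaceP h; exists (a * letter l); exact: hs_end. Qed.

Lemma halfspace_neqT h : exists z, ~ val h z.
Proof. by have [a [l ->]] := halfspaceP h; exists a; exact: hs_start. Qed.

Lemma hs_inj a l (b : raag e) l' :
  hs a l = hs b l' -> l = l' /\ link_group l.1 (a^-1 * b).
Proof.
move=> E; have h1 := @hs_start a l; have h2 := hs_end a l.
rewrite E in h1 h2; have [-> vab] := hs_enter h1 h2; split=> //.
exact: link_group_sym.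
Qed.

Lemma halfspace_enter h a l :
  ~ val h a -> val h (a * letter l) -> val h = hs a l.
Proof.
have [b [l' ->]] := halfspaceP h => h1 h2.
by have [-> /hs_coset] := hs_enter h1 h2.
Qed.

(** [hs_inj] recovers the letter from the halfspace, so the choice made in [label] does not
    matter. *)
Lemma label_hs h a l : val h = hs a l -> label h = l.1.
Proof.
rewrite /label; case: cid => /= v [g [_ [->|->]]] E.
  have [|<- _] := @hs_inj (g * letter (v, true)) (opp_letter (v, true)) a l => //.
  by rewrite -E /hs letterVK.
by have [<-] := @hs_inj g (v, true) a l E.
Qed.

Lemma val_translateP g h z : val (translate_halfspace g h) z <-> val h (g^-1 * z).
Proof.
split=> [[y hy <-]|hz]; first by rewrite mulKg.
by exists (g^-1 * z) => //; rewrite mulVKg.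
Qed.

Lemma val_translateE g h z : val (translate_halfspace g h) (g * z) <-> val h z.
Proof. by rewrite val_translateP mulKg. Qed.

Lemma val_translate_hs g h a l :
  val h = hs a l -> val (translate_halfspace g h) = hs (g * a) l.
Proof.
move=> E; apply: halfspace_enter; rewrite -?mulgA val_translateE E.
  exact: hs_start.
exact: hs_end.
Qed.

Lemma label_translate g h : label (translate_halfspace g h) = label h.
Proof.
have [a [l E]] := halfspaceP h.
by rewrite (label_hs E) (label_hs (val_translate_hs g E)).
Qed.

Lemma halfspace_eqP h k : (forall z, val h z <-> val k z) -> h = k.
Proof. by move=> H; apply/val_inj/seteqP; split=> z /H. Qed.

Lemma translate_halfspaceM g g' h :
  translate_halfspace g (translate_halfspace g' h) = translate_halfspace (g * g') h.
Proof. by apply: halfspace_eqP => z; rewrite !val_translateP invgM mulgA. Qed.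

Lemma translate_halfspace1 h : translate_halfspace 1 h = h.
Proof. by apply: halfspace_eqP => z; rewrite val_translateP invg1 mul1g. Qed.

Lemma translate_halfspaceK g :
  cancel (translate_halfspace g) (translate_halfspace g^-1 : _ -> halfspace e).
Proof. by move=> h; rewrite translate_halfspaceM mulVg translate_halfspace1. Qed.

Lemma translate_halfspaceVK g :
  cancel (translate_halfspace g^-1) (translate_halfspace g : _ -> halfspace e).
Proof. by move=> h; rewrite translate_halfspaceM mulgV translate_halfspace1. Qed.

Lemma translate_sub g h k : val h `<=` val k <->
  val (translate_halfspace g h) `<=` val (translate_halfspace g k).
Proof.
split=> hk z; first by rewrite !val_translateP => /hk.
by have := hk (g * z); rewrite !val_translateE.
Qed.

Lemma setC_halfspace h : ~` val h \in @halfspaces V e.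
Proof. by have [a [l ->]] := halfspaceP h; rewrite hsC; exact: hs_halfspace. Qed.

Definition opp_halfspace h : halfspace e := SigSub (setC_halfspace h).

Lemma val_opp h z : val (opp_halfspace h) z <-> ~ val h z.
Proof. by []. Qed.

Lemma opp_halfspaceK : involutive opp_halfspace.
Proof. by move=> h; apply: val_inj; exact: setCK. Qed.

Lemma label_opp h : label (opp_halfspace h) = label h.
Proof.
have [a [l E]] := halfspaceP h; rewrite (label_hs E).
by apply: (@label_hs _ (a * letter l) (opp_letter l)); rewrite -hsC -E.
Qed.

Lemma opp_sub h k : val h `<=` val k <->
  val (opp_halfspace k) `<=` val (opp_halfspace h).
Proof.
split=> hk z; first by rewrite !val_opp => kz /hk.
by move=> hz; apply: contrapT => kz; exact: (hk z kz hz).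
Qed.

Lemma translate_opp g h : translate_halfspace g (opp_halfspace h) =
  opp_halfspace (translate_halfspace g h).
Proof.
apply: halfspace_eqP => z.
by rewrite val_translateP !val_opp val_translateP.
Qed.

(** Translating keeps the sign of the letter that enters a halfspace, while complementing flips
    it. *)
Lemma translate_neq_opp g h : translate_halfspace g h <> opp_halfspace h.
Proof.
have [a [l E]] := halfspaceP h => /(congr1 val).
rewrite (val_translate_hs g E) /= E hsC => /hs_inj[].
by case: l {E} => v [].
Qed.

Lemma halfspace_comparable h k x z : ~~ e (label h) (label k) ->
    ~ val h x -> ~ val k x -> val h z -> val k z ->
  val h `<=` val k \/ val k `<=` val h.
Proof.
have [a [l Eh]] := halfspaceP h; have [b [l' Ek]] := halfspaceP k.
by rewrite (label_hs Eh) (label_hs Ek) Eh Ek; exact: hs_comparable.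
Qed.

(** Each letter of a word leading from [x] to [z] enters only one halfspace. *)
Lemma finite_separating x z : finite_set (separating x z).
Proof.
suff H w : finite_set (separating x (x * raag_of_word e w)).
  by rewrite -(mulVKg x z) -(raag_reprK (x^-1 * z)).
elim: w x => [|l w IH] x.
  rewrite raag_of_word0 mulg1; apply: sub_finite_set (finite_set0 _).
  by move=> h [].
rewrite raag_of_word_cons mulgA.
apply: (@sub_finite_set _ _ ([set mkhs x l] `|` separating (x * letter l)
   (x * letter l * raag_of_word e w))); last first.
  by rewrite finite_setU; split; [exact: finite_set1|exact: IH].
move=> h [h1 h2]; have [hl|hl] := pselect (val h (x * letter l)); last by right.
by left; apply/val_inj/halfspace_enter.
Qed.

Lemma opp_letter_neq l : opp_letter l <> l.
Proof. by case: l => v []. Qed.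

Lemma halfspace_anti h k : val h `<=` val k -> val k `<=` val h -> h = k.
Proof. by move=> hk kh; apply/val_inj/seteqP. Qed.

(* Join edges dual to [h] and [k] by a shortest possible path: the label of its
   first edge is not linked to the common label of [h] and [k], so that the
   halfspace this edge enters is nested with both. *)
Lemma opposite_between a (b : raag e) l h k :
    val h = hs a l -> val k = hs b (opp_letter l) -> val k `<=` val h ->
  exists j, [/\ val k `<=` val j, val j `<=` val h, j <> h & j <> k].
Proof.
move: {2}(dist _ b) (leqnn (dist (a * letter l) b)) => n.
elim: n a => [|n IH] a.
  (* Here [k] is the complement of [h], yet nonempty and contained in [h]. *)
  rewrite leqn0 => /eqP/dist0 Eb Eh Ek kh.
  have [z kz] := halfspace_neq0 k; have := kh _ kz.
  by move: kz; rewrite Ek -Eb -hsC -Eh.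
have [[|l0 w] Eb Ew] := geodesic_word (a * letter l) b.
  by move=> _; apply: IH; rewrite -Ew.
rewrite -Ew [size _]/= ltnS => wn Eh Ek kh.
have {}Eb : b = a * letter l * letter l0 * raag_of_word e w.
  by rewrite Eb raag_of_word_cons mulgA.
(* If [l0] is linked to [l], the square they span shows that [a * letter l0] also starts an edge
   dual to [h], and this edge is closer to [b]. *)
have [ll0|ll0] := boolP (e l.1 l0.1).
  apply: (IH (a * letter l0)) => //.
    by rewrite -mulgA -(letterC ll0) mulgA Eb (leq_trans (dist_word _ _)).
  by rewrite Eh; apply: hs_coset; rewrite mulKg; exact: link_group_letter.
pose j := mkhs (a * letter l) l0.
have ha : ~ val h a by rewrite Eh; exact: hs_start.
have hal : val h (a * letter l) by rewrite Eh; exact: hs_end.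
have kb : ~ val k b by rewrite Ek; exact: hs_start.
have kbl : val k (b * letter (opp_letter l)) by rewrite Ek; exact: hs_end.
have hb : val h b.
  apply: contrapT => hb.
  have := halfspace_enter hb (kh _ kbl).
  by rewrite Eh => /hs_inj[/esym/opp_letter_neq].
have jal : ~ val j (a * letter l) by exact: hs_start.
have jb : val j b.
  rewrite /= /hs /closer /= dist_sym (dist_sym b) -Ew /= ltnS Eb.
  exact: dist_word.
(* Otherwise [j] is the complement of [h], although [b] lies in both. *)
have ja : ~ val j a.
  move=> ja; have := @halfspace_enter j (a * letter l) (opp_letter l) jal.
  rewrite letterVK -hsC -Eh => /(_ ja) Ej.
  by move: jb; rewrite Ej; apply.
have jh : val j `<=` val h.
  have [|//|hj] := @halfspace_comparable j h a b _ ja ha jb hb.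
    by rewrite (label_hs Eh) (label_hs (erefl (val j))) e_sym.
  by have /jal := hj _ hal.
(* Otherwise [j] is the complement of [k], so that [a] lies in [j] or in [k], both contained in
   [h]. *)
have jbl : val j (b * letter (opp_letter l)).
  apply: contrapT => jbl.
  have := @halfspace_enter j _ l jbl.
  rewrite letterKV => /(_ jb) Ej; apply: ha.
  have [ka|ka] := pselect (val k a); first exact: kh.
  apply: jh; rewrite Ej -[X in hs _ X a](opp_letterK l) -hsN.
  by rewrite -Ek.
have kj : val k `<=` val j.
  have ka : ~ val k a by move/kh.
  have [|//|jk] := @halfspace_comparable k j a _ _ ka ja kbl jbl.
    by rewrite (label_hs Ek) (label_hs (erefl (val j))).
  by have /kb := jk _ jb.
exists j; split=> // E; first by rewrite E in jal.
by rewrite E in jb.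
Qed.

(** * Intervals of halfspaces and the exclusion of reflections *)

Definition interval k h : set (halfspace e) :=
  [set j | val k `<=` val j /\ val j `<=` val h].

Lemma finite_interval k h : finite_set (interval k h).
Proof.
have [x hx] := halfspace_neqT h; have [z kz] := halfspace_neq0 k.
apply: (@sub_finite_set _ _ (separating x z)) (finite_separating x z).
by move=> j [kj jh]; split; [exact: kj|move/jh].
Qed.

Lemma card_interval_lt k h k' h' j : interval k' h' `<=` interval k h ->
    interval k h j -> ~ interval k' h' j ->
  (#|` fset_set (interval k' h')| < #|` fset_set (interval k h)|)%N.
Proof.
move=> sub hj h'j; apply: card_fset_set_lt sub hj h'j.
exact: finite_interval.
Qed.

(* The halfspaces with the label of [c] form a chain, on which [phi] is an
   order-reversing map whose centre lies between [d] and [c]; it fixes no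
   halfspace, so it swaps two consecutive elements of the chain. These have a
   halfspace in between, which [phi] moves to another one of the same label, so
   that the pair of these two is a smaller instance. *)
Lemma no_reflection g c d x z :
    let phi h := translate_halfspace g (opp_halfspace h) in
    label c = label d -> val d `<=` val c -> d <> c ->
    val (phi c) `<=` val c -> val d `<=` val (phi d) ->
    ~ val c x -> ~ val (phi d) x -> val d z -> val (phi c) z ->
  False.
Proof.
move=> phi.
have phi_lab h : label (phi h) = label h by rewrite label_translate label_opp.
have phi_neq h : phi h <> h.
  rewrite -{2}(opp_halfspaceK h); exact: translate_neq_opp.
have phi_le h k : val h `<=` val k <-> val (phi k) `<=` val (phi h).
  by rewrite opp_sub; exact: translate_sub.
have phi_onto h : exists2 h', phi h' = h & label h' = label h.
  exists (opp_halfspace (translate_halfspace g^-1 h)).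
    by rewrite /phi opp_halfspaceK translate_halfspaceVK.
  by rewrite label_opp label_translate.
have [n] := ubnP #|` fset_set (interval d c)|%N.
elim: n c d => // n IH c d cn lcd cd d_neq_c phic phid cx phidx dz phicz.
(* The induction hypothesis for a pair spanning a strictly smaller interval. *)
have step c' d' : label c' = label d' -> val d' `<=` val c' -> d' <> c' ->
    val d `<=` val d' -> val c' `<=` val c -> d' <> d \/ c' <> c ->
    val (phi c') `<=` val c' -> val d' `<=` val (phi d') ->
    ~ val (phi d') x -> val (phi c') z -> False.
  move=> ? ? ? dd' c'c neq ? ? ? ?; apply: (IH c' d') => //.
  - have sub : interval d' c' `<=` interval d c.
      by move=> j [h1 h2]; split; [apply: subset_trans h1|apply: subset_trans c'c].
    rewrite -ltnS; apply: leq_ltn_trans cn; case: neq => neq.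
      apply: (card_interval_lt sub (_ : interval d c d)); first by split.
      by move=> [h1 h2]; apply: neq; exact: halfspace_anti.
    apply: (card_interval_lt sub (_ : interval d c c)); first by split.
    by move=> [h1 h2]; apply: neq; exact: halfspace_anti.
  - by move/c'c.
  - exact: dd'.
have comp h k : label h = label k -> ~ val h x -> ~ val k x ->
    val h z -> val k z -> val h `<=` val k \/ val k `<=` val h.
  by move=> hk; apply: halfspace_comparable; rewrite hk e_irr.
(* [c] and [d] are consecutive for their label: for a strictly intermediate [k], comparing [phi k]
   with [k] makes [(k, d)] or [(c, k)] a smaller instance. *)
have cons k : label k = label c -> val d `<=` val k -> val k `<=` val c ->
    k = d \/ k = c.
  move=> lk dk kc; apply: contrapT => /not_orP[kd_neq kc_neq].
  have phick := (phi_le _ _).1 kc; have phikd := (phi_le _ _).1 dk.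
  have kx : ~ val k x by move/kc.
  have phikx : ~ val (phi k) x by move/phikd.
  have kz := dk _ dz; have phikz := phick _ phicz.
  have [h|h] := comp (phi k) k (phi_lab k) phikx kx phikz kz.
    by apply: (step k d) => //; [rewrite lk|move=> E; exact: kd_neq|right].
  by apply: (step c k) => //; left.
have dx : ~ val d x by move/cd.
have phicx : ~ val (phi c) x by move/phic.
have lphic : label (phi c) = label d by rewrite phi_lab.
have cz : val c z by exact: cd.
have phidz : val (phi d) z by exact: phid.
have phic_d : val (phi c) `<=` val d.
  have [//|h] := comp _ _ lphic phicx dx phicz dz.
  by case: (cons _ (phi_lab c) h phic) => [-> //|/phi_neq].
have c_phid : val c `<=` val (phi d).
  have [|//|h] := comp c (phi d) _ cx phidx cz phidz; first by rewrite phi_lab.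
  by case: (cons (phi d)  _ phid h) => [|/phi_neq//|-> //]; rewrite phi_lab.
(* The preimage of [d] lies between [d] and [c], hence is one of them, and [phi] does not fix
   [d]. *)
have Ec : phi c = d.
  have [j Ej lj] := phi_onto d.
  have [|||E|E] := cons j; rewrite ?lj//.
  - by apply/phi_le; rewrite Ej.
  - by apply/phi_le; rewrite Ej.
  - by move: Ej; rewrite E => /phi_neq.
  - by rewrite -E.
have Ed : phi d = c.
  have [j Ej lj] := phi_onto c.
  have [|||E|E] := cons j; rewrite ?lj//.
  - by apply/phi_le; rewrite Ej.
  - by apply/phi_le; rewrite Ej Ec.
  - by rewrite -E.
  - by move: Ej; rewrite E => /phi_neq.
have [a [l Ea]] := halfspaceP c.
(* As [d] is a translate of the complement of [c], it is entered by the opposite letter, which is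
   what [opposite_between] requires. *)
have Eb : val d = hs (g * (a * letter l)) (opp_letter l).
  by rewrite -Ec; apply: val_translate_hs; rewrite /= Ea hsC.
have [j [dj jc j_neq_c j_neq_d]] := opposite_between Ea Eb cd.
have phij_c : val (phi j) `<=` val c by rewrite -Ed -phi_le.
have d_phij : val d `<=` val (phi j) by rewrite -Ec -phi_le.
have jx : ~ val j x by move/jc.
have phijx : ~ val (phi j) x by move/phij_c.
(* [phi] applied twice is a translation that need not be trivial, so its image of [j] needs bounds
   of its own. *)
have phi2 : val d `<=` val (phi (phi j)) /\ val (phi (phi j)) `<=` val c.
  by split; [rewrite -Ec -phi_le|rewrite -Ed -phi_le].
have phi2x : ~ val (phi (phi j)) x by move/phi2.2.
have [h|h] := comp (phi j) j (phi_lab j) phijx jx (d_phij _ dz) (dj _ dz).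
- apply: (step j (phi j) _ h (phi_neq j) d_phij jc _ h _ phi2x (d_phij _ dz)).
  + by rewrite phi_lab.
  + by right.
  + exact: (phi_le _ _).1 h.
- apply: (step (phi j) j (phi_lab j) h _ dj phij_c _ _ h phijx (phi2.1 _ dz)).
  + by move/esym/phi_neq.
  + by left.
  + exact: (phi_le _ _).1 h.
Qed.

(** * Segments and their translates *)

Local Notation tight := (fun h k : halfspace e => `[< tightly_nested h k >]).

(** Induction on the size of the interval: if the pair is not tight, an intermediate halfspace
    splits it into two smaller intervals. *)
Lemma tight_path h k : val k `<=` val h ->
  exists2 p, path tight h p & last h p = k.
Proof.
have [n] := ubnP #|` fset_set (interval k h)|%N.
elim: n h k => // n IH h k cn kh.
have [->|hk] := pselect (h = k); first by exists [::].
have [ht|ht] := pselect (tightly_nested h k).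
  by exists [:: k] => //=; rewrite andbT; apply/asboolP.
have [j [jh jk j_h k_j]] : exists j, [/\ j <> h, j <> k,
    val j `<=` val h & val k `<=` val j].
  by apply: contrapT => nj; apply: ht; split.
have [|p hp Ep] := IH h j _ j_h.
  rewrite -ltnS; apply: leq_ltn_trans cn.
  apply: (@card_interval_lt _ _ _ _ k).
  - by move=> i [h1 h2]; split=> //; exact: subset_trans h1.
  - by split.
  - by move=> [h1 h2]; apply: jk; exact: halfspace_anti.
have [|q hq Eq] := IH j k _ k_j.
  rewrite -ltnS; apply: leq_ltn_trans cn.
  apply: (@card_interval_lt _ _ _ _ h).
  - by move=> i [h1 h2]; split=> //; exact: subset_trans j_h.
  - by split.
  - by move=> [h1 h2]; apply: jh; exact: halfspace_anti.
by exists (p ++ q); rewrite ?cat_path ?last_cat Ep// hp hq.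
Qed.

Lemma tight_path_sub h p k : path tight h p -> k \in h :: p ->
  val (last h p) `<=` val k /\ val k `<=` val h.
Proof.
elim: p h k => [|j p IH] h k /=; first by rewrite inE => _ /eqP->; split=> ?.
move=> /andP[/asboolP[jh _ _] hp]; rewrite inE => /predU1P[->|/(IH _ _ hp)[h1 h2]].
  split=> //; apply: subset_trans jh.
  by have [] := IH _ j hp (mem_head _ _).
by split=> //; exact: subset_trans jh.
Qed.

Lemma tight_translate g h k : tight h k ->
  tight (translate_halfspace g h) (translate_halfspace g k).
Proof.
move=> /asboolP[kh hk nex]; apply/asboolP; split.
- exact: (translate_sub g _ _).1 kh.
- by move/(can_inj (translate_halfspaceK g)).
- move=> [j [jh jk j_h k_j]]; apply: nex; exists (translate_halfspace g^-1 j).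
  split.
  + by move=> E; apply: jh; rewrite -E translate_halfspaceVK.
  + by move=> E; apply: jk; rewrite -E translate_halfspaceVK.
  + by apply/(translate_sub g _ _).2; rewrite translate_halfspaceVK.
  + by apply/(translate_sub g _ _).2; rewrite translate_halfspaceVK.
Qed.

Lemma translates_inP h p x z t : path tight h p ->
  translates_in (h :: p) x z t <-> exists g,
    [/\ t = map (translate_halfspace g) (h :: p),
        ~ val (translate_halfspace g h) x
      & val (translate_halfspace g (last h p)) z].
Proof.
move=> hp; split=> [[[g Et] ht]|[g [Et hx hz]]].
  exists g; split=> //.
  - by have [] := ht (translate_halfspace g h); rewrite ?Et ?mem_head.
  - by have [] := ht (translate_halfspace g (last h p)); rewrite // Et map_f// mem_last.
split; first by exists g.
move=> _ /[!Et] /mapP[j /(tight_path_sub hp)[h1 h2] ->].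
have {}h1 := (translate_sub g _ _).1 h1; have {}h2 := (translate_sub g _ _).1 h2.
by split; [exact: h1|move/h2].
Qed.

Lemma separating_comparable h k x z : label h = label k ->
    separating x z h -> separating x z k ->
  val h `<=` val k \/ val k `<=` val h.
Proof.
by move=> hk [? ?] [? ?]; apply: (@halfspace_comparable _ _ x z) => //; rewrite hk e_irr.
Qed.

(** Two such successors are comparable; were they distinct, the larger would lie strictly between
    [h] and the smaller. *)
Lemma tight_fun h k k' x z : separating x z k -> separating x z k' ->
  tight h k -> tight h k' -> label k = label k' -> k = k'.
Proof.
move=> sk sk' /asboolP[kh hk nk] /asboolP[k'h hk' nk'] lkk'.
apply: contrapT => kk'; have [sub|sub] := separating_comparable lkk' sk sk'.
  by apply: nk; exists k'; split => //; exact: nesym.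
by apply: nk'; exists k; split => //; exact: nesym.
Qed.

Lemma tight_inj h k k' x z : separating x z k -> separating x z k' ->
  tight k h -> tight k' h -> label k = label k' -> k = k'.
Proof.
move=> sk sk' /asboolP[kh hk nk] /asboolP[k'h hk' nk'] lkk'.
apply: contrapT => kk'; have [sub|sub] := separating_comparable lkk' sk sk'.
  by apply: nk'; exists k; split.
by apply: nk; exists k'; split => //; exact: nesym.
Qed.

Lemma translates_in_sorted h p x z t : path tight h p ->
  translates_in (h :: p) x z t ->
  [/\ sorted tight t, map (@label _ _) t = map (@label _ _) (h :: p)
    & forall k, k \in t -> separating x z k].
Proof.
move=> hp [[g ->] ht]; split=> //; last first.
  by rewrite -map_comp; apply: eq_map => k; exact: label_translate.
rewrite sorted_map; apply: (sub_path (e := tight)) hp => i j; exact: tight_translate.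
Qed.

(* Tightly nested successors with the same label in one separating set are nested
   with each other, hence equal. *)
Lemma translates_in_ohead_inj h p x z t t' : path tight h p ->
    translates_in (h :: p) x z t -> translates_in (h :: p) x z t' ->
  ohead t = ohead t' -> t = t'.
Proof.
move=> hp /(translates_in_sorted hp)[st lt ht] /(translates_in_sorted hp)[st' lt' ht'] E.
apply: (@sorted_map_inj _ _ (separating x z) tight (@label _ _)) => //.
  by move=> a b c hb hc; exact: (tight_fun hb hc).
by rewrite lt lt'.
Qed.

Lemma translates_in_last_inj h p x z t t' : path tight h p ->
    translates_in (h :: p) x z t -> translates_in (h :: p) x z t' ->
  ohead (rev t) = ohead (rev t') -> t = t'.
Proof.
move=> hp /(translates_in_sorted hp)[st lt ht] /(translates_in_sorted hp)[st' lt' ht'] E.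
apply: (inv_inj revK).
apply: (@sorted_map_inj _ _ (separating x z) (fun k h => tight h k) (@label _ _)).
- by move=> a b c hb hc; exact: (tight_inj hb hc).
- by rewrite rev_sorted.
- by rewrite rev_sorted.
- by [].
- by rewrite !map_rev lt lt'.
- by move=> k; rewrite mem_rev; exact: ht.
- by move=> k; rewrite mem_rev; exact: ht'.
Qed.

(** A translate is recovered from its first halfspace, which ranges over a finite set. This makes
    [num_translates_in] a genuine count. *)
Lemma finite_translates_in h p x z : path tight h p ->
  finite_set (translates_in (h :: p) x z).
Proof.
move=> hp; pose F k := xget [::]
  [set t | translates_in (h :: p) x z t /\ ohead t = Some k].
apply: (sub_finite_set _ (finite_image F (finite_separating x z))) => t ht.
have [k Ek kx] : exists2 k, ohead t = Some k & separating x z k.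
  have [[g Et] hk] := ht; exists (translate_halfspace g h); first by rewrite Et.
  by apply: hk; rewrite Et mem_head.
exists k => //; rewrite /F; case: xgetP => [t' _ [ht' Et']|/(_ t)[]//].
by apply: (translates_in_ohead_inj hp ht' ht); rewrite Et'.
Qed.

(** * Dependence of the count on the endpoints *)

Definition num_separating x z := #|` fset_set (separating x z)|.

Lemma num_separatingM g x z :
  num_separating (g * x) (g * z) = num_separating x z.
Proof.
have H g' x' z' : (num_separating x' z' <= num_separating (g' * x')%g (g' * z')%g)%N.
  apply: (card_fset_set_inj (f := translate_halfspace g')).
  - exact: finite_separating.
  - exact: finite_separating.
  - by move=> h [h1 h2]; split; rewrite val_translateE.
  - by move=> h k _ _ /(can_inj (translate_halfspaceK g')).
by apply/eqP; rewrite eqn_leq H andbT; have := H g^-1 (g * x) (g * z); rewrite !mulKg.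
Qed.

(** A translate lost on passing from [x] to [x'] starts with a halfspace separating these two
    vertices, and is determined by it. *)
Lemma num_translates_in_lel h p x x' z : path tight h p ->
  (num_translates_in (h :: p) x z <=
   num_translates_in (h :: p) x' z + num_separating x x')%N.
Proof.
move=> hp; have fin y y' := finite_translates_in y y' hp.
pose B := [set t | translates_in (h :: p) x z t /\ val (head h t) x'].
have fB : finite_set B by apply: sub_finite_set (fin x z) => t [].
apply: (@leq_trans #|` fset_set (translates_in (h :: p) x' z `|` B)|%N).
  apply: card_fset_set_le; first by rewrite finite_setU; split.
  move=> t ht; have [ht'|ht'] := pselect (val (head h t) x'); first by right.
  left; move: ht ht' => /(translates_inP _ _ _ hp)[g [Et hx hz]].
  rewrite Et /= => hx'; apply/(translates_inP _ _ _ hp); exists g; split=> //.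
apply: leq_trans (card_fset_setU_le (fin _ _) fB) _; rewrite leq_add2l.
apply: (card_fset_set_inj (f := head h)) => //; first exact: finite_separating.
  by move=> t [/(translates_inP _ _ _ hp)[g [-> hx hz]]].
move=> t t' [ht _] [ht' _] E; apply: (translates_in_ohead_inj hp ht ht').
by move: ht ht' E => [[g ->] _] [[g' ->] _] /= ->.
Qed.

(** Here a lost translate is determined by its last halfspace, which separates [z'] from [z]. *)
Lemma num_translates_in_ler h p x z z' : path tight h p ->
  (num_translates_in (h :: p) x z <=
   num_translates_in (h :: p) x z' + num_separating z' z)%N.
Proof.
move=> hp; have fin y y' := finite_translates_in y y' hp.
pose B := [set t | translates_in (h :: p) x z t /\ ~ val (last h t) z'].
have fB : finite_set B by apply: sub_finite_set (fin x z) => t [].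
apply: (@leq_trans #|` fset_set (translates_in (h :: p) x z' `|` B)|%N).
  apply: card_fset_set_le; first by rewrite finite_setU; split.
  move=> t ht; have [ht'|ht'] := pselect (val (last h t) z'); last by right.
  left; move: ht ht' => /(translates_inP _ _ _ hp)[g [Et hx hz]].
  rewrite Et /= last_map => hz'; apply/(translates_inP _ _ _ hp).
  by exists g; split.
apply: leq_trans (card_fset_setU_le (fin _ _) fB) _; rewrite leq_add2l.
apply: (card_fset_set_inj (f := last h)) => //; first exact: finite_separating.
  by move=> t [/(translates_inP _ _ _ hp)[g [-> hx]]] /=; rewrite last_map.
move=> t t' [ht _] [ht' _] E; apply: (translates_in_last_inj hp ht ht').
move: ht ht' E => [[g ->] _] [[g' ->] _].
by rewrite /= !lastI !rev_rcons /= !last_map => ->.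
Qed.

(** * The axis of an element *)

(* A vertex [y] of minimal displacement lies on an axis of [g], so that the
   halfspace entered by the first edge of a geodesic from [y] to [g y] is
   mapped properly into itself. *)
Lemma axis_halfspace g : g <> 1 -> exists y h l,
  [/\ val h = hs y l, val h (g * y),
      val (translate_halfspace g h) `<=` val h & translate_halfspace g h <> h].
Proof.
move=> g1.
have [y ymin] : exists y, forall x, (dist y (g * y)%g <= dist x (g * x)%g)%N.
  have ex : exists n, `[< exists y, dist y (g * y) = n >].
    by exists (dist 1 (g * 1)); apply/asboolP; exists 1.
  have [n /asboolP[y Ey] nmin] := ex_minnP ex; exists y => x.
  by rewrite Ey; apply: nmin; apply/asboolP; exists x.
have [[|l w] Ew sw] := geodesic_word y (g * y).
  have : g * y * y^-1 = y * y^-1 by rewrite {1}Ew raag_of_word0 mulg1.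
  by rewrite mulgK mulgV => /g1.
pose h := mkhs y l; exists y, h, l.
have hgy : val h (g * y).
  rewrite /h /= /hs /closer /= dist_sym (dist_sym _ y) -sw /= ltnS.
  by rewrite Ew raag_of_word_cons mulgA; exact: dist_word.
have hy : ~ val h y by exact: hs_start.
have Eg : val (translate_halfspace g h) = hs (g * y) l.
  exact: val_translate_hs.
have ghgy : ~ val (translate_halfspace g h) (g * y) by rewrite Eg; exact: hs_start.
have ghgyl : val (translate_halfspace g h) (g * y * letter l).
  by rewrite Eg; exact: hs_end.
(* Otherwise the edge at [g * y] leaves [h], and the translate of [h] is its complement. *)
have hgyl : val h (g * y * letter l).
  apply: contrapT => hgyl.
  have := @halfspace_enter h (g * y * letter l) (opp_letter l) hgyl.
  rewrite letterVK => /(_ hgy); rewrite -hsC -Eg => E.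
  apply: (@translate_neq_opp g h); apply: val_inj.
  by rewrite [RHS](_ : _ = ~` val h)// E setCK.
(* Otherwise passing from [y] to [y * letter l] strictly decreases the displacement, in two steps:
   first at the image end, then at the starting end. *)
have ghy : ~ val (translate_halfspace g h) y.
  rewrite Eg /hs /closer /= => ltD.
  have := hgyl; rewrite /h /= /hs /closer /=.
  rewrite dist_sym (dist_sym _ y) => ltD'.
  have := ymin (y * letter l); rewrite mulgA leqNgt.
  by rewrite (ltn_trans ltD' ltD).
have sub : val (translate_halfspace g h) `<=` val h.
  have [|//|hg] := @halfspace_comparable (translate_halfspace g h) h y _ _ ghy hy ghgyl hgyl.
    by rewrite label_translate e_irr.
  by have /ghgy := hg _ hgy.
by split=> // E; move: ghgy; rewrite E.
Qed.

(** * Translates of a segment along the axis *)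

Section Axis.
Variables (g y : raag e) (h : halfspace e) (l : V * bool) (p : seq (halfspace e)).
Hypotheses (h_hs : val h = hs y l) (h_gy : val h (g * y)).
Hypothesis gh_sub : val (translate_halfspace g h) `<=` val h.
Hypothesis gh_neq : translate_halfspace g h <> h.
Hypotheses (p_path : path tight h p) (p_last : last h p = translate_halfspace g h).

Let H n := translate_halfspace (g ^+ n) h.
Let s := h :: p.

Lemma axisS n : H n.+1 = translate_halfspace g (H n).
Proof. by rewrite /H expgS translate_halfspaceM. Qed.

Lemma axisSr n : H n.+1 = translate_halfspace (g ^+ n) (translate_halfspace g h).
Proof. by rewrite /H expgSr translate_halfspaceM. Qed.

Lemma axis0 : H 0 = h.
Proof. by rewrite /H expg0 translate_halfspace1. Qed.

Lemma axisD m n : translate_halfspace (g ^+ m) (H n) = H (m + n).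
Proof.
elim: m => [|m IH]; first by rewrite expg0 translate_halfspace1.
by rewrite expgS -translate_halfspaceM IH -axisS.
Qed.

Lemma axis_sub m n : (m <= n)%N -> val (H n) `<=` val (H m).
Proof.
move=> /subnK <-; elim: (n - m)%N => [|k IH]; first by move=> ?.
rewrite addSn; apply: subset_trans IH; rewrite axisSr; exact: (translate_sub _ _ _).1.
Qed.

Lemma axis_neqS n : H n.+1 <> H n.
Proof. by rewrite axisSr => /(can_inj (translate_halfspaceK _)). Qed.

Lemma axis_hs n : val (H n) = hs (g ^+ n * y) l.
Proof. exact: val_translate_hs. Qed.

Lemma axis_label n : label (H n) = label h.
Proof. exact: label_translate. Qed.

Lemma axis_start n : ~ val h y /\ ~ val (H n) y.
Proof.
have hy : ~ val h y by rewrite h_hs; exact: hs_start.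
by split=> // /(axis_sub (leq0n n)); rewrite axis0.
Qed.

Lemma axis_orbit n : val (H n) (g ^+ n.+1 * y).
Proof. by rewrite expgSr -mulgA /H val_translateE. Qed.

Lemma axis_orbit_start n : ~ val (H n) (g ^+ n * y).
Proof. by rewrite axis_hs; exact: hs_start. Qed.

(** A halfspace with the label of [h] that separates the two orbit points is comparable with [h] and
    [H n]. The end [H n] is left out because it is only entered after the vertex [g ^+ n * y]. *)
Lemma axis_separating n k : label k = label h ->
  separating y (g ^+ n * y) k <->
  [/\ val (H n) `<=` val k, val k `<=` val h & k <> H n].
Proof.
have [hy Hy] := axis_start n.
have e_label (i j : halfspace e) : label i = label j -> ~~ e (label i) (label j).
  by move=> ->; rewrite e_irr.
move=> lk; split=> [[kn ky]|[Hk kh kH]]; last first.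
  split; last by move/kh.
  apply: contrapT => kn; apply: kH; apply: val_inj.
  rewrite axis_hs; apply: halfspace_enter => //; apply: Hk.
  by rewrite axis_hs; exact: hs_end.
case: n kn Hy => [|n] kn Hy; first by rewrite expg0 mul1g in kn.
have hn : val h (g ^+ n.+1 * y).
  by have := axis_sub (leq0n n) (axis_orbit n); rewrite axis0.
(* If instead [k] contained [h], the first edge at [y] would enter [k] as well, forcing [k = h]. *)
have kh : val k `<=` val h.
  have [//|hk] := halfspace_comparable (e_label _ _ lk) ky hy kn hn.
  have := @halfspace_enter k y l ky; rewrite -h_hs => -> //.
  by apply: hk; rewrite h_hs; exact: hs_end.
have Hl : val (H n.+1) (g ^+ n.+1 * y * letter l) by rewrite axis_hs; exact: hs_end.
(* Comparing [k] with [H n.+1] needs a common point, namely the far end of the edge at the orbit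
   point. Were it outside [k], then [k] would be the complement of [H n.+1], which contains [y]. *)
have kl : val k (g ^+ n.+1 * y * letter l).
  apply: contrapT => kl.
  have := @halfspace_enter k _ (opp_letter l) kl; rewrite letterVK => /(_ kn) E.
  by apply: ky; rewrite E -hsC -axis_hs.
have neq : k <> H n.+1 by move=> E; apply: (@axis_orbit_start n.+1); rewrite -E.
split=> //.
have [||//] := @halfspace_comparable k (H n.+1) _ _ _ ky Hy kl Hl.
  by apply: e_label; rewrite axis_label.
by move=> kH; have := kH _ kn => /axis_orbit_start.
Qed.

Let translates n := translates_in s y (g ^+ n * y).

Lemma axis_translatesP n t : translates n t <-> exists g',
  [/\ t = map (translate_halfspace g') s, ~ val (translate_halfspace g' h) y
    & val (translate_halfspace g' (translate_halfspace g h)) (g ^+ n * y)].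
Proof. by rewrite -p_last; exact: translates_inP. Qed.

Lemma axis_translate_sub g' : val (translate_halfspace g' (translate_halfspace g h))
  `<=` val (translate_halfspace g' h).
Proof. exact: (translate_sub _ _ _).1. Qed.

Lemma axis_translates_sub n : translates n `<=` translates n.+1.
Proof.
move=> t /axis_translatesP[g' [-> hy hn]]; apply/axis_translatesP; exists g'.
split=> //.
have lk : label (translate_halfspace g' (translate_halfspace g h)) = label h.
  by rewrite !label_translate.
have [|Hk kh kH] := (axis_separating n lk).1.
  by split => // /axis_translate_sub.
have [|//] := (axis_separating n.+1 lk).2; split=> //.
  exact: subset_trans (axis_sub (leqnSn n)) Hk.
move=> E; apply: (@axis_neqS n); apply: halfspace_anti; first exact: axis_sub.
by rewrite -E.
Qed.

Let new_translates n := translates n.+1 `\` translates n.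

Lemma finite_axis_translates n : finite_set (translates n).
Proof. exact: finite_translates_in. Qed.

Lemma finite_new_translates n : finite_set (new_translates n).
Proof. apply: sub_finite_set (finite_axis_translates n.+1); exact: subDsetl. Qed.

Lemma num_axis_translatesS n : num_translates_in s y (g ^+ n.+1 * y) =
  (num_translates_in s y (g ^+ n * y)%g + #|` fset_set (new_translates n)|)%N.
Proof.
rewrite -card_fset_setU//; first last.
- by move=> t ? [].
- exact: finite_new_translates.
- exact: finite_axis_translates.
by rewrite setDUK//; exact: axis_translates_sub.
Qed.

(** Translation by [g] is injective and carries new translates to new ones: the first halfspace lies
    in [h], so its image lies in the translate of [h] and still avoids [y]. *)
Lemma num_new_translates_le n :
  (#|` fset_set (new_translates n)| <= #|` fset_set (new_translates n.+1)|)%N.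
Proof.
apply: (card_fset_set_inj (f := map (translate_halfspace g)));
  [exact: finite_new_translates|exact: finite_new_translates| |]; last first.
  by move=> t t' _ _; apply/inj_map/can_inj; exact: translate_halfspaceK.
move=> t [/axis_translatesP[g' [-> hy hn]] nt].
have gg' k : translate_halfspace (g * g') k = translate_halfspace g (translate_halfspace g' k).
  by rewrite translate_halfspaceM.
have E : [seq translate_halfspace g i | i <- [seq translate_halfspace g' i | i <- s]] =
    [seq translate_halfspace (g * g') i | i <- s].
  by rewrite -map_comp; apply: eq_map => i /=; rewrite gg'.
rewrite E; split.
  apply/axis_translatesP; exists (g * g'); split=> //.
  - rewrite gg' => hy'; apply: (axis_start 0).1.
    have lk : label (translate_halfspace g' h) = label h by rewrite label_translate.
    have [|_ kh _] := (axis_separating n.+1 lk).1.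
      by split=> //; exact: axis_translate_sub.
    by apply: gh_sub; apply: ((translate_sub g _ _).1 kh).
  - by rewrite gg' expgS -mulgA val_translateE.
move=> nt'; apply: nt; apply/axis_translatesP; exists g'; split=> //.
have [_ hN] := nt'; have := hN (translate_halfspace (g * g') (translate_halfspace g h)).
case=> [|+ _].
  by apply: map_f; rewrite -p_last mem_last.
by rewrite gg' expgS -mulgA val_translateE.
Qed.

(** A new translate is determined by its last halfspace, which separates two successive orbit
    points. *)
Lemma num_new_translates_bounded n :
  (#|` fset_set (new_translates n)| <= num_separating y (g * y)%g)%N.
Proof.
rewrite -(num_separatingM (g ^+ n)) mulgA -expgSr.
apply: (card_fset_set_inj (f := last h)).
- exact: finite_new_translates.
- exact: finite_separating.
- move=> t [/axis_translatesP[g' [-> hy hn]] nt]; rewrite [last _ _]/= last_map p_last.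
  split=> // hn'; apply: nt; apply/axis_translatesP; by exists g'.
- move=> t t' [ht _] [ht' _] E; apply: (translates_in_last_inj p_path ht ht').
  move: ht ht' E => [[g1 ->] _] [[g2 ->] _].
  by rewrite /= !lastI !rev_rcons /= !last_map => ->.
Qed.

(** The translate of [s] by [g ^+ n] ends at [H n.+1], which contains the orbit point of index
    [n.+2] but not that of index [n.+1]; hence the successor in the statement. *)
Lemma num_new_translates_gt0 n : (0 < #|` fset_set (new_translates n.+1)|)%N.
Proof.
apply: (@card_fset_set_gt0 _ _ (map (translate_halfspace (g ^+ n)) s)).
  exact: finite_new_translates.
have hy := (axis_start n).2.
split.
  apply/axis_translatesP; exists (g ^+ n).
  by rewrite -axisSr; split=> //; exact: axis_orbit.
move=> [_ /(_ (H n.+1))[]]; first by rewrite axisSr -p_last map_f// mem_last.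
by move=> /axis_orbit_start.
Qed.

(* If [g'] reverses [s] inside the axis then, after shifting by a power of [g],
   [phi : k |-> g' k^c] satisfies [phi h <= h] and [g h <= phi (g h)], so that it
   is a reflection as excluded by [no_reflection]. *)
Lemma num_axis_translates_rev n : num_translates_in s (g ^+ n * y) y = 0%N.
Proof.
rewrite /num_translates_in (_ : translates_in _ _ _ = set0) ?fset_set0 ?cardfs0//.
apply/seteqP; split=> // t /(translates_inP _ _ _ p_path)[g' [_]]; rewrite p_last.
pose phi k := translate_halfspace g' (opp_halfspace k) => hn hy.
have phiP k z : val (phi k) z <-> ~ val (translate_halfspace g' k) z.
  by rewrite /phi translate_opp val_opp.
have ba : val (phi h) `<=` val (phi (translate_halfspace g h)).
  by apply: (translate_sub g' _ _).1; exact: (opp_sub _ _).1.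
have lphi k : label (phi k) = label k by rewrite label_translate label_opp.
have la : label (phi (translate_halfspace g h)) = label h by rewrite lphi label_translate.
have [|Hb bh bH] := (axis_separating n (lphi h)).1.
  by split; [exact/phiP|move/ba/phiP].
have [|Ha ah aH] := (axis_separating n la).1.
  by split; [exact/ba/phiP|move/phiP].
set a := phi (translate_halfspace g h) in ba la Ha ah aH *.
(* The power to shift by: [a] will lie between the consecutive translates [H i] and [H i.+1]. *)
have [i [i_n aHi aHi1]] : exists i,
    [/\ (i < n)%N, val a `<=` val (H i) & ~ (val a `<=` val (H i.+1))].
  have : ~ (val a `<=` val (H n)).
    by move=> aHn; apply: aH; exact: halfspace_anti.
  elim: n {hn Hb bh bH Ha aH} => [|n IH] nn; first by rewrite axis0 in nn.
  have [aHn|aHn] := pselect (val a `<=` val (H n)); first by exists n.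
  by have [i [? ? ?]] := IH aHn; exists i; split=> //; exact: ltnW.
have [z zH] := halfspace_neq0 (H n).
have HHi : val (H n) `<=` val (H i.+1) by exact: axis_sub.
have Hia : val (H i.+1) `<=` val a.
  have [|||//|//] := @halfspace_comparable a (H i.+1) y z _ _ _ (Ha _ zH) (HHi _ zH).
  - by rewrite axis_label la e_irr.
  - by move=> /ah; exact: (axis_start 0).1.
  - exact: (axis_start _).2.
have shift k : translate_halfspace ((g ^+ i)^-1 * g') (opp_halfspace k) =
    translate_halfspace (g ^+ i)^-1 (phi k) by rewrite translate_halfspaceM.
have Ei m : translate_halfspace (g ^+ i)^-1 (H (i + m)) = H m.
  by rewrite -axisD translate_halfspaceK.
have aih : val (translate_halfspace (g ^+ i)^-1 a) `<=` val h.
  by rewrite -axis0 -Ei addn0; exact: (translate_sub _ _ _).1.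
(* The common interior point for [no_reflection]: as [i < n], it lies in [H 1], and the shifted
   image of [h] contains [H (n - i)]. *)
have [z' z'H] := halfspace_neq0 (H (n - i)).
have E1 : H 1 = translate_halfspace g h by rewrite /H expg1.
apply: (@no_reflection ((g ^+ i)^-1 * g') h (H 1) y z'); rewrite ?shift ?E1 -/a.
- by rewrite label_translate.
- exact: gh_sub.
- exact: gh_neq.
- exact: subset_trans ((translate_sub _ _ _).1 ba) aih.
- by rewrite -E1 -Ei addn1; exact: (translate_sub _ _ _).1.
- exact: (axis_start 0).1.
- by move/aih; exact: (axis_start 0).1.
- by rewrite -E1; apply: axis_sub z'H; rewrite subn_gt0.
- apply: ((translate_sub _ _ _).1 Hb).
  by rewrite -(subnKC (ltnW i_n)) Ei.
Qed.

(** [c] is the eventual number of new translates per step. The equation is written with sums to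
    avoid truncated subtraction. *)
Lemma num_axis_translates_linear : exists N c, (0 < c)%N /\
  forall n, (N <= n)%N -> (num_translates_in s y (g ^+ n * y)%g + N * c =
    num_translates_in s y (g ^+ N * y)%g + n * c)%N.
Proof.
have [N dN] := nondecreasing_bounded_const num_new_translates_le
  num_new_translates_bounded.
exists N, #|` fset_set (new_translates N)|; split.
  by rewrite -(dN N.+1 (leqnSn N)); exact: num_new_translates_gt0.
move=> n /subnKC <-; elim: (n - N)%N => [|k IH]; first by rewrite addn0.
by rewrite addnS num_axis_translatesS dN ?leq_addr// mulSn addnAC IH addnA addnAC -addnA.
Qed.

(** Each endpoint is moved separately, and [num_separatingM] makes the cost at the far end
    independent of [n]. The backward count is compared with zero at [y]. *)
Lemma num_translates_in_change_base x n :
  let C := (num_separating x y + num_separating y x)%N in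
  [/\ (num_translates_in s x (g ^+ n * x)%g <=
        num_translates_in s y (g ^+ n * y)%g + C)%N,
      (num_translates_in s y (g ^+ n * y)%g <=
        num_translates_in s x (g ^+ n * x)%g + C)%N
    & (num_translates_in s (g ^+ n * x)%g x <= C)%N].
Proof.
move=> C; have L := num_translates_in_lel _ _ _ p_path.
have U := num_translates_in_ler _ _ _ p_path.
rewrite /C; split.
- apply: leq_trans (L x y _) _; rewrite (addnC (num_separating x y)) addnA leq_add2r.
  by apply: leq_trans (U _ _ (g ^+ n * y)) _; rewrite num_separatingM.
- apply: leq_trans (L y x _) _; rewrite addnA leq_add2r.
  by apply: leq_trans (U _ _ (g ^+ n * x)) _; rewrite num_separatingM.
- apply: leq_trans (L _ (g ^+ n * y) _) _; rewrite num_separatingM addnC leq_add2l.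
  by apply: leq_trans (U _ _ y) _; rewrite num_axis_translates_rev.
Qed.

Lemma axis_homogenisation (R : realType) x :
  (1 <= homogenisation (median_qm R s x) g)%R.
Proof.
have [N [c [c0 linear]]] := num_axis_translates_linear.
pose C := (num_separating x y + num_separating y x)%N.
(* The homogenisation equals [c]. In the error bound, one [C] is for the forward count, one for the
   backward count, and the rest comes from starting the linear growth at [N]. *)
rewrite /homogenisation (@limn_div R _ c%:R
  (C + C + N * c + num_translates_in s y (g ^+ N * y)%g)%:R N) ?ler1n//.
move=> n /linear /(congr1 (fun m => m%:R : R)).
have [] := num_translates_in_change_base x n; rewrite -/C /median_qm /median_f.
rewrite -!(ler_nat R) !natrD !natrM => h1 h2 h3 h4.
set u := num_translates_in s x _ in h1 h2 *.
set v := num_translates_in s _ x in h3 *.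
have v0 : (0 <= v%:R :> R)%R by exact: ler0n.
have N0 : (0 <= N%:R * c%:R :> R)%R by rewrite mulr_ge0.
have a0 : (0 <= (num_translates_in s y (g ^+ N * y)%g)%:R :> R)%R by exact: ler0n.
by rewrite ler_norml; apply/andP; split; lra.
Qed.

End Axis.

Lemma independent_diag u v : u = v -> independent e [set u; v]%SET.
Proof.
by move=> <- i j; rewrite !inE !orbb => /eqP-> /eqP->; rewrite e_irr.
Qed.

End Walls.

Theorem proposition5p9 (R : realType) (V : finType) (e : rel V)
    (e_sym : symmetric e) (e_irr : irreflexive e)
    (gamma : raag e) (x : raag e) :
  gamma <> 1%g ->
  exists (l : nat) (s : l.+1.-tuple (halfspace e)),
    [/\ segment s,
        (1 <= homogenisation (median_qm R s x) gamma)%R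
      & independent e [set label (tnth s ord0); label (tnth s ord_max)]%SET].
Proof.
move=> /(axis_halfspace e_sym e_irr)[y [h [l [h_hs h_gy gh_sub gh_neq]]]].
have [p hp lp] := tight_path e_sym e_irr gh_sub.
exists (size p), (in_tuple (h :: p)); split; first by rewrite /segment /=.
  exact: (axis_homogenisation e_sym e_irr h_hs h_gy gh_sub gh_neq hp lp).
(* The last halfspace is a translate of the first, so both ends have the same label, and the graph
   has no loops. *)
apply: independent_diag => //.
rewrite !(tnth_nth h) /= (nth_last h (h :: p)) /= lp.
by rewrite label_translate.
Qed.
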